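(* Let $A$ be decomposed into a core $K_0$ and ends $U_1,\dots,U_m$ with exhaustions $h_i$ and admissible weights $\varphi_i$ as in the context, and assume all $\varphi_i$ are unbounded. Let $f\in C(A)$. Then $\|[f]\|^{\sharp}_{\mathbf{h},\boldsymbol{\varphi}}<\infty$ if and only if $f$ has a limit $L_i:=\lim_{a\to\omega_i}f(a)\in\mathbb{R}$ at each end and $\varphi_i(h_i)\,|f-L_i|$ is bounded on $U_i$ for each $i$. In that case, for each $i=1,\dots,m$, the infimum $N_i(f)$ is attained at the unique constant $c=L_i$, and $$\|[f]\|^{\sharp}_{\mathbf{h},\boldsymbol{\varphi}}=\max\Bigl\{\operatorname{osc}_{K_0}(f),\ \max_{1\le i\le m}\ \sup_{U_i}\varphi_i(h_i)|f-L_i|\Bigr\}.$$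
   Context: $A$ is a non-compact, locally compact, $\sigma$-compact Hausdorff space; $C(A)$ is the space of real continuous functions on $A$ and $[f]$ the class of $f$ in $C(A)/\mathbb{R}$ (modulo constants). Decomposition at infinity: there is a compact $K_0\subset A$ (the core) and finitely many pairwise disjoint, open, connected, non-compact sets $U_1,\dots,U_m$ (the ends) with $A\setminus K_0=\bigsqcup_{i=1}^m U_i$. Each $U_i$ carries a continuous $h_i:U_i\to[0,\infty)$ such that (E1) $\{x\in U_i:h_i(x)\le R\}$ is relatively compact in $A$ for every $R<\infty$; (E2) $h_i$ extends continuously to $\overline{U_i}$ with $h_i\equiv0$ on $\partial U_i\subset K_0$; (E3) $h_i$ is unbounded on $U_i$; (E4) $\partial U_i=\overline{U_i}\setminus U_i\neq\varnothing$. Each end carries an admissible weight $\varphi_i$. Admissible means: $\varphi:[0,\infty)\to[1,\infty)$ is continuous, non-decreasing, $\varphi(0)=1$, and there is $K\ge1$ with $\varphi(r+s)\le K\varphi(r)\varphi(s)$ for all $r,s\ge0$. Unbounded means $\varphi(t)\to\infty$ as $t\to\infty$. $\omega_i$ denotes the point at infinity of $U_i$: $a_k\to\omega_i$ means $a_k\in U_i$ eventually and $h_i(a_k)\to\infty$. For $f\in C(A)$: $\operatorname{osc}_{K_0}(f):=N_0(f):=\inf_{c\in\mathbb{R}}\sup_{x\in K_0}|f(x)-c|$, $N_i(f):=\inf_{c\in\mathbb{R}}\sup_{x\in U_i}\varphi_i(h_i(x))|f(x)-c|$ for $i=1,\dots,m$, and $\|[f]\|^{\sharp}_{\mathbf{h},\boldsymbol{\varphi}}:=\max\{N_0(f),N_1(f),\dots,N_m(f)\}\in[0,\infty]$.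 *)

(* Defs.v *)
From HB Require Import structures.
From mathcomp Require Import all_boot all_order all_algebra.
From mathcomp Require Import all_classical all_reals all_analysis.

Set Implicit Arguments.
Unset Strict Implicit.
Unset Printing Implicit Defensive.

Import Order.TTheory GRing.Theory Num.Theory.
Import numFieldNormedType.Exports.

Local Open Scope classical_set_scope.
Local Open Scope ring_scope.

Definition sigma_compact (T : topologicalType) : Prop :=
  exists K : nat -> set T,
    (forall n, compact (K n)) /\ \bigcup_n K n = [set: T].

(* A function on an end [U], or on the half-line, is encoded as a function on
   the whole type; only its values on [U], or on [0, +oo[, are ever used. *)

Record is_end (R : realType) (T : topologicalType) (K0 U : set T)
    (h : T -> R) : Prop := IsEnd {
  end_open : open U;
  end_connected : connected U;
  end_noncompact : ~ compact U;
  exhaustion_ge0 : forall x, U x -> 0 <= h x;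
  exhaustion_continuous : {within U, continuous h};
  exhaustion_precompact :
    forall r : R, precompact [set x | U x /\ h x <= r];
  exhaustion_extension : exists g : T -> R,
    [/\ {within closure U, continuous g},
        forall x, U x -> g x = h x &
        forall x, (closure U `\` U) x -> g x = 0];
  end_frontier_core : closure U `\` U `<=` K0;
  exhaustion_unbounded : forall M : R, exists2 x, U x & M < h x;
  end_frontier_neq0 : closure U `\` U !=set0 }.

Record decomposition_at_infinity (R : realType) (T : topologicalType) (m : nat)
    (K0 : set T) (U : 'I_m -> set T) (h : 'I_m -> T -> R) : Prop :=
  DecompositionAtInfinity {
  core_compact : compact K0;
  core_setC : ~` K0 = \bigcup_i U i;
  ends_disjoint : trivIset [set: 'I_m] U;
  ends_is_end : forall i, is_end K0 (U i) (h i) }.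

Record admissible_weight (R : realType) (phi : R -> R) : Prop :=
  AdmissibleWeight {
  weight_ge1 : forall t, 0 <= t -> 1 <= phi t;
  weight_continuous : {within `[0, +oo[, continuous phi};
  weight_nondecreasing : forall s t, 0 <= s -> s <= t -> phi s <= phi t;
  weight0 : phi 0 = 1;
  weight_submultiplicative : exists2 K : R, 1 <= K &
    forall r s, 0 <= r -> 0 <= s -> phi (r + s) <= K * phi r * phi s }.

Definition unbounded_weight (R : realType) (phi : R -> R) : Prop :=
  phi t @[t --> +oo] --> +oo.

(* [a k] tends to the point at infinity of the end [U] with exhaustion [h]. *)
Definition tends_to_end (R : realType) (T : Type) (U : set T) (h : T -> R)
    (a : nat -> T) : Prop :=
  (\forall k \near \oo, U (a k)) /\ h (a k) @[k --> \oo] --> +oo.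

Definition lim_at_end (R : realType) (T : Type) (U : set T) (h : T -> R)
    (f : T -> R) (L : R) : Prop :=
  forall a : nat -> T, tends_to_end U h a -> f (a k) @[k --> \oo] --> L.

Definition osc (R : realType) (T : Type) (K0 : set T) (f : T -> R) : \bar R :=
  ereal_inf (range (fun c : R =>
    ereal_sup [set (`|f x - c|)%:E | x in K0])).

Definition weighted_dev (R : realType) (T : Type) (U : set T) (h : T -> R)
    (phi : R -> R) (f : T -> R) (c : R) : \bar R :=
  ereal_sup [set (phi (h x) * `|f x - c|)%:E | x in U].

Definition end_norm (R : realType) (T : Type) (U : set T) (h : T -> R)
    (phi : R -> R) (f : T -> R) : \bar R :=
  ereal_inf (range (weighted_dev U h phi f)).

Definition sharp_norm (R : realType) (T : Type) (m : nat) (K0 : set T)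
    (U : 'I_m -> set T) (h : 'I_m -> T -> R) (phi : 'I_m -> R -> R)
    (f : T -> R) : \bar R :=
  maxe (osc K0 f) (\big[maxe/-oo%E]_(i < m) end_norm (U i) (h i) (phi i) f).

Lemma inf_shift (R : realType) (F G : R -> \bar R) (d : R) :
  (forall c, G c = F (c - d)) -> ereal_inf (range G) = ereal_inf (range F).
Proof.
move=> FG; congr ereal_inf; apply/seteqP; split => _ [c _ <-].
  by exists (c - d).
by exists (c + d); rewrite // FG addrK.
Qed.

(* [sharp_norm] is defined on representatives; it only depends on the class of
   [f] modulo constants. *)
Lemma sharp_norm_addc (R : realType) (T : Type) (m : nat) (K0 : set T)
    (U : 'I_m -> set T) (h : 'I_m -> T -> R) (phi : 'I_m -> R -> R)
    (f : T -> R) (d : R) :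
  sharp_norm K0 U h phi (fun x => f x + d) = sharp_norm K0 U h phi f.
Proof.
have shift x c : f x + d - c = f x - (c - d) by rewrite opprB addrA.
congr maxe; first by apply: (@inf_shift _ _ _ d) => c; under eq_fun do
  rewrite shift.
apply: eq_bigr => i _; apply: (@inf_shift _ _ _ d) => c.
by rewrite /weighted_dev; under eq_fun do rewrite shift.
Qed.

(* Main.v *)
(* A finite weighted deviation from [c] forces [f] to tend to [c] at the end,
   because the weight tends to infinity there. As limits at an end are unique,
   at most one constant has finite deviation, so the infimum defining the end
   norm is over a single relevant value. The core contributes a finite term by
   compactness. *)

Require Import Defs.
From HB Require Import structures.
From mathcomp Require Import all_boot all_order all_algebra.
From mathcomp Require Import all_classical all_reals all_analysis.

Set Implicit Arguments.
Unset Strict Implicit.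
Unset Printing Implicit Defensive.

Import Order.TTheory GRing.Theory Num.Theory.
Import numFieldNormedType.Exports.

Local Open Scope classical_set_scope.
Local Open Scope ring_scope.

Section ends.
Variables (R : realType) (T : Type) (U : set T) (h : T -> R).

Lemma weighted_dev_lty (phi : R -> R) (f : T -> R) (c : R) :
  (weighted_dev U h phi f c < +oo)%E <->
  exists M : R, forall x, U x -> phi (h x) * `|f x - c| <= M.
Proof.
split=> [dev_fin|[M leM]]; last first.
  apply: (@le_lt_trans _ _ M%:E); last exact: ltry.
  by apply: ge_ereal_sup => _ [x Ux <-]; rewrite lee_fin leM.
have ub x : U x -> ((phi (h x) * `|f x - c|)%:E <= weighted_dev U h phi f c)%E.
  by move=> Ux; apply: ereal_sup_ubound; exists x.
case: (weighted_dev U h phi f c) dev_fin ub => [M _ ub| // |_ ub].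
  by exists M => x /ub; rewrite lee_fin.
(* Supremum [-oo]: [ub] then rules out any point of [U], so the bound 0 holds vacuously. *)
by exists 0 => x /ub.
Qed.

Lemma weighted_dev_lty_lim (phi : R -> R) (f : T -> R) (c : R) :
  unbounded_weight phi -> (weighted_dev U h phi f c < +oo)%E ->
  lim_at_end U h f c.
Proof.
move=> phi_oo /weighted_dev_lty[M leM] a [Ua ha].
have /cvgryPge phia : phi (h (a k)) @[k --> \oo] --> +oo.
  exact: cvg_comp ha phi_oo.
apply/cvgrPdist_le => e e_gt0; near=> k.
(* Past this threshold [phi * e] exceeds [M], which bounds [phi * |f - c|]; dividing by [phi] gives
   [|f - c| <= e]. The [+ 1] keeps the threshold positive even when [M = 0]. *)
have phi_ge : (`|M| + 1) / e <= phi (h (a k)) by near: k; exact: phia.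
have phi_gt0 : 0 < phi (h (a k)) by apply: lt_le_trans phi_ge; rewrite divr_gt0.
rewrite distrC -(ler_pM2l phi_gt0); apply: (@le_trans _ _ M).
  by apply: leM; near: k.
apply: (le_trans (ler_norm M)); apply: (@le_trans _ _ (`|M| + 1)).
  by rewrite lerDl.
by rewrite -ler_pdivrMr.
Unshelve. all: by end_near. Qed.

(** Unboundedness of [h] supplies a sequence tending to the end, along which both limits are
    compared; with no such sequence [lim_at_end] would hold vacuously for every constant. *)
Lemma lim_at_end_unique (f : T -> R) (L L' : R) :
  (forall M : R, exists2 x, U x & M < h x) ->
  lim_at_end U h f L -> lim_at_end U h f L' -> L = L'.
Proof.
move=> h_unbounded limL limL'.
have /choice[a aP] (k : nat) : exists x, U x /\ k%:R < h x.
  by have [x Ux hx] := h_unbounded k%:R; exists x.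
have a_end : tends_to_end U h a.
  split; first by apply: nearW => k; have [] := aP k.
  apply: (@ger_cvgy _ _ _ _ (fun k : nat => k%:R)); last exact: cvgr_idn.
  by apply: nearW => k; apply: ltW; have [] := aP k.
exact: cvg_unique (limL a a_end) (limL' a a_end).
Qed.

Lemma end_norm_lty (phi : R -> R) (f : T -> R) :
  (end_norm U h phi f < +oo)%E <->
  exists c : R, (weighted_dev U h phi f c < +oo)%E.
Proof.
split=> [/ereal_inf_lt[_ [c _ <-] ?]|[c]]; first by exists c.
by apply: le_lt_trans; apply: ereal_inf_lbound; exists c.
Qed.

(* By uniqueness of the limit at the end, the deviation from any constant other
   than [L] is infinite. *)
Lemma end_norm_attained (phi : R -> R) (f : T -> R) (L : R) :
  (forall M : R, exists2 x, U x & M < h x) -> unbounded_weight phi ->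
  (end_norm U h phi f < +oo)%E -> lim_at_end U h f L ->
  forall c, weighted_dev U h phi f c = end_norm U h phi f <-> c = L.
Proof.
move=> h_unbounded phi_oo norm_fin limL.
have dev_fin c : (weighted_dev U h phi f c < +oo)%E -> c = L.
  move=> /(weighted_dev_lty_lim phi_oo) limc.
  exact: lim_at_end_unique h_unbounded limc limL.
move=> c; split=> [dev_c|->]; first by apply: dev_fin; rewrite dev_c.
apply/eqP; rewrite eq_le; apply/andP; split; last first.
  by apply: ereal_inf_lbound; exists L.
apply: le_ereal_inf_tmp => _ [d _ <-].
have [/dev_fin-> //|] := ltP (weighted_dev U h phi f d) +oo%E.
by apply: le_trans; exact: leey.
Qed.

End ends.

(** The image of [K] is compact, hence bounded, so the competitor [c = 0] already has a finite
    supremum. *)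
Lemma osc_compact_lty (R : realType) (T : topologicalType) (K : set T)
  (f : T -> R) : compact K -> continuous f -> (osc K f < +oo)%E.
Proof.
move=> K_compact f_cont.
have /compact_bounded[M [_ /(_ (M + 1))]] : compact (f @` K).
  by apply: continuous_compact => //; exact: continuous_subspaceT.
(* Boundedness only provides bounds strictly above [M], hence [M + 1]. *)
rewrite ltrDl => /(_ ltr01) leM; apply: (@le_lt_trans _ _ (M + 1)%:E).
  apply: ge_ereal_inf; exists (ereal_sup [set (`|f x - 0|)%:E | x in K]).
    by exists 0.
  apply: ge_ereal_sup => _ [x Kx <-]; rewrite lee_fin subr0.
  by apply: leM; exists x.
exact: ltry.
Qed.

(** A finite maximum is below [+oo] exactly when each term is, and the core term always is. The
    initial value [-oo] covers [m = 0]. *)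
Lemma sharp_norm_lty (R : realType) (T : topologicalType) (m : nat)
    (K0 : set T) (U : 'I_m -> set T) (h : 'I_m -> T -> R) (phi : 'I_m -> R -> R)
    (f : T -> R) : compact K0 -> continuous f ->
  (sharp_norm K0 U h phi f < +oo)%E <->
  forall i, (end_norm (U i) (h i) (phi i) f < +oo)%E.
Proof.
move=> K0_compact f_cont.
rewrite /sharp_norm gt_max osc_compact_lty //=.
split=> [/bigmax_ltP[_ +] i|norm_fin]; first exact.
by apply/bigmax_ltP; split.
Qed.

Theorem theorem8p7 (R : realType) (A : topologicalType)
  (A_noncompact : ~ compact [set: A])
  (A_locally_compact : locally_compact [set: A])
  (A_sigma_compact : sigma_compact A)
  (A_hausdorff : hausdorff_space A)
  (m : nat) (K0 : set A) (U : 'I_m -> set A) (h : 'I_m -> A -> R)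
  (phi : 'I_m -> R -> R)
  (dec : decomposition_at_infinity K0 U h)
  (phi_admissible : forall i, admissible_weight (phi i))
  (phi_unbounded : forall i, unbounded_weight (phi i))
  (f : A -> R) (f_continuous : continuous f) :
  ((sharp_norm K0 U h phi f < +oo)%E <->
   (forall i, exists L : R,
      lim_at_end (U i) (h i) f L /\
      exists M : R, forall x, U i x -> phi i (h i x) * `|f x - L| <= M)) /\
  ((sharp_norm K0 U h phi f < +oo)%E ->
   forall L : 'I_m -> R, (forall i, lim_at_end (U i) (h i) f (L i)) ->
     (forall i (c : R),
        weighted_dev (U i) (h i) (phi i) f c = end_norm (U i) (h i) (phi i) f
        <-> c = L i) /\
     sharp_norm K0 U h phi f =
       maxe (osc K0 f)
         (\big[maxe/-oo%E]_(i < m)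
            ereal_sup [set (phi i (h i x) * `|f x - L i|)%:E | x in U i])).
Proof.
have K0_compact := core_compact dec.
have h_unbounded i := exhaustion_unbounded (ends_is_end dec i).
have sharp_fin := sharp_norm_lty U h phi K0_compact f_continuous.
split.
  rewrite sharp_fin; split=> [norm_fin i|limM i].
    have /end_norm_lty[L dev_fin] := norm_fin i.
    (* The constant witnessing a finite infimum is itself the limit at the end. *)
    exists L; split; first exact: weighted_dev_lty_lim dev_fin.
    exact/weighted_dev_lty.
  by have [L [_ /weighted_dev_lty ?]] := limM i; apply/end_norm_lty; exists L.
move=> /sharp_fin norm_fin L limL.
have attained i := end_norm_attained (h_unbounded i) (phi_unbounded i)
  (norm_fin i) (limL i).
split=> //; congr maxe; apply: eq_bigr => i _.
(* The supremum is [weighted_dev] at [L i] unfolded, and attainment at [c = L i] equates it with the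
   end norm. *)
by apply/esym/attained.
Qed.
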